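(* Let $1<p,q<\infty$ with $p^{-1}+q^{-1}=1$. Let $K\in L_0(\Omega\times\Omega')$ be a generalized Mercer kernel, $K(x,y)=\sum_{n\in\mathbb{N}}\phi_n(x)\phi_n'(y)$ (pointwise convergent), whose expansion sets $\{\phi_n:n\in\mathbb{N}\}\subseteq L_0(\Omega)$ and $\{\phi_n':n\in\mathbb{N}\}\subseteq L_0(\Omega')$ are linearly independent and satisfy $$\sum_{n\in\mathbb{N}}|\phi_n(x)|^q<\infty\ \text{ for all }x\in\Omega,\qquad\sum_{n\in\mathbb{N}}|\phi_n'(y)|^p<\infty\ \text{ for all }y\in\Omega'.$$ Then the space $$\mathcal{B}_K^p(\Omega):=\Big\{f=\sum_{n\in\mathbb{N}}a_n\phi_n:(a_n)_{n\in\mathbb{N}}\in\ell_p\Big\},\qquad\|f\|_{\mathcal{B}_K^p(\Omega)}:=\Big(\sum_{n\in\mathbb{N}}|a_n|^p\Big)^{1/p},$$ is a two-sided reproducing kernel Banach space with the two-sided reproducing kernel $K$.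
   Context: $\Omega,\Omega'$ are locally compact Hausdorff spaces equipped with regular Borel measures $\mu,\mu'$. $L_0(X)$ denotes the set of real-valued measurable functions on $X$ (genuine functions). A set (here: countable family) of functions is linearly independent if no nontrivial finite linear combination of distinct members vanishes. $\ell_p$ is the space of real sequences with the standard $p$-norm. The norm of $\mathcal{B}_K^p(\Omega)$ is taken to be well defined in terms of the coefficients $(a_n)$; the series defining $f$ converge pointwise. Two-sided reproducing kernel Banach space: let $K\in L_0(\Omega\times\Omega')$ and let $\mathcal{B}$ be a Banach space consisting of functions in $L_0(\Omega)$ whose continuous dual $\mathcal{B}'$ is isometrically isomorphic to a normed space $\mathcal{F}$ consisting of functions in $L_0(\Omega')$, identified with $\mathcal{B}'$; write $\langle f,G\rangle_{\mathcal{B}}:=G(f)$. $\mathcal{B}$ is a two-sided reproducing kernel Banach space with two-sided reproducing kernel $K$ if (i) $K(x,\cdot)\in\mathcal{F}\cong\mathcal{B}'$ for each $x\in\Omega$; (ii) $\langle f,K(x,\cdot)\rangle_{\mathcal{B}}=f(x)$ for all $f\in\mathcal{B}$, $x\in\Omega$; (iii) $K(\cdot,y)\in\mathcal{B}$ for each $y\in\Omega'$; (iv) $\langle K(\cdot,y),g\rangle_{\mathcal{B}}=g(y)$ for all $g\in\mathcal{F}$, $y\in\Omega'$.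
   Formalization: The formal theorem also assumes that the ℓ_q-norm of the coefficients of an expansion in the φ'_n depends only on the function; without this (finite linear independence does not give it) a nonzero functional can vanish at every K(·,y) and the claim fails. *)

(* Defs.v *)
From HB Require Import structures.
From mathcomp Require Import all_boot all_order all_algebra.
From mathcomp Require Import all_classical all_reals all_analysis.
Set Implicit Arguments.
Unset Strict Implicit.
Unset Printing Implicit Defensive.
Import Order.TTheory GRing.Theory Num.Theory.
Import numFieldNormedType.Exports.
Local Open Scope classical_set_scope.
Local Open Scope ring_scope.

(* Pointedness is required by [measurableType]; it only excludes the empty
   space, on which no nonempty family of functions is linearly independent. *)
Definition borel (X : ptopologicalType) := g_sigma_algebraType (@open X).

(* Regularity of a Borel measure in the sense of Rudin (Real and Complex
   Analysis, 2.15): every Borel set is both outer and inner regular. *)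
Definition regular_borel_measure (R : realType) (X : ptopologicalType)
    (mu : {measure set (borel X) -> \bar R}) : Prop :=
  forall E : set (borel X), measurable E ->
    mu E = ereal_inf [set mu U | U in [set U : set X | open U /\ E `<=` U]] /\
    mu E = ereal_sup [set mu C | C in [set C : set X | compact C /\ C `<=` E]].

Definition L0 (R : realType) d (T : measurableType d) : set (T -> R) :=
  [set f | measurable_fun [set: T] f].

Section sequences.
Variables (R : realType) (p : R).

Definition ell : set (R^nat) :=
  [set a | cvgn (series (fun n => `|a n| `^ p))].

Definition ell_norm (a : R^nat) : R :=
  (limn (series (fun n => `|a n| `^ p))) `^ p^-1.

End sequences.

Section expansions.
Variables (R : realType) (X : Type).
Implicit Types (p : R) (phi : nat -> X -> R) (f : X -> R).

Definition linearly_independent phi : Prop :=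
  forall (m : nat) (c : nat -> R),
    (forall x, \sum_(i < m) c i * phi i x = 0) ->
    forall i, (i < m)%N -> c i = 0.

Definition is_expansion phi (a : R^nat) f : Prop :=
  forall x, series (fun n => a n * phi n x) @ \oo --> f x.

Definition expansion_space p phi : set (X -> R) :=
  [set f | exists2 a, ell p a & is_expansion phi a f].

(* The p-norm of the coefficients depends on [f] alone.  Linear independence
   of [phi] does not give this, as it only concerns finite combinations.  For
   the adjoint expansion set and the exponent q, it makes the space that
   represents the dual a normed space: a nonzero b in l_q whose expansion
   vanishes would give a nonzero functional vanishing at every K(., y). *)
Definition expansion_norm_well_defined p phi : Prop :=
  forall (f : X -> R) (a b : R^nat), ell p a -> ell p b ->
    is_expansion phi a f -> is_expansion phi b f ->
    ell_norm p a = ell_norm p b.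

(* Meaningful under [expansion_norm_well_defined], for [f] in
   [expansion_space p phi]: the choice of coefficients is then immaterial. *)
Definition expansion_norm p phi f : R :=
  ell_norm p (get [set a | ell p a /\ is_expansion phi a f]).

End expansions.

Section kernels.
Variables (R : realType) (X Y : ptopologicalType).
Implicit Type K : borel X * borel Y -> R.

Definition generalized_mercer_kernel K (phi : nat -> borel X -> R)
    (phi' : nat -> borel Y -> R) : Prop :=
  [/\ L0 K, forall n, L0 (phi n), forall n, L0 (phi' n) &
      forall x y, series (fun n => phi n x * phi' n y) @ \oo --> K (x, y)].

End kernels.

Section normed_function_spaces.
Variable R : realType.

(* [V] is identified, through the evaluation map [ev], with a space of
   functions on [T] that belong to [L0 T]. *)
Definition function_space d (T : measurableType d) (V : normedModType R)
    (ev : V -> T -> R^o) : Prop :=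
  [/\ linear ev, injective ev & forall v, L0 (ev v : T -> R)].

Definition continuous_dual (V : normedModType R) : set (V -> R^o) :=
  [set G | linear G /\ continuous G].

Definition dual_norm (V : normedModType R) (G : V -> R^o) : R :=
  sup [set `|G v| | v in [set v : V | `|v| <= 1]].

(* [J] is an isometric isomorphism from [F] onto the continuous dual of [V]. *)
Definition dual_isometry (V F : normedModType R) (J : F -> V -> R^o) : Prop :=
  [/\ linear J, set_bij [set: F] (@continuous_dual V) J &
      forall g, dual_norm (J g) = `|g|].

End normed_function_spaces.

Section two_sided.
Variables (R : realType) (X Y : ptopologicalType).
Variable K : borel X * borel Y -> R.

(* [J g f] is the pairing <f, g>. *)
Definition two_sided_reproducing
    (V : normedModType R) (evV : V -> borel X -> R^o)
    (F : normedModType R) (evF : F -> borel Y -> R^o)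
    (J : F -> V -> R^o) : Prop :=
  (forall x, exists2 k : F, evF k = (fun y => K (x, y)) &
     forall f : V, J k f = evV f x) /\
  (forall y, exists2 k : V, evV k = (fun x => K (x, y)) &
     forall g : F, J g k = evF g y).

Definition two_sided_rkbs
    (V : completeNormedModType R) (evV : V -> borel X -> R^o) : Prop :=
  [/\ L0 K, function_space evV &
    exists (F : normedModType R) (evF : F -> borel Y -> R^o)
        (J : F -> V -> R^o),
      [/\ function_space evF, dual_isometry J &
          two_sided_reproducing evV evF J]].

(* The set of functions [B], with the pointwise operations and the norm [N]
   (whose values outside [B] are irrelevant), is a two-sided reproducing kernel
   Banach space with kernel [K]. *)
Definition is_two_sided_rkbs (B : set (borel X -> R))
    (N : (borel X -> R) -> R) : Prop :=
  exists (V : completeNormedModType R) (evV : V -> borel X -> R^o),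
    [/\ range evV = B, forall v, N (evV v) = `|v| & two_sided_rkbs evV].

End two_sided.

(* Main.v *)
Require Import Defs.
From HB Require Import structures.
From mathcomp Require Import all_boot all_order all_algebra.
From mathcomp Require Import all_classical all_reals all_analysis.
From mathcomp Require Import measurable_realfun.
Import Order.TTheory GRing.Theory Num.Theory.
Import numFieldNormedType.Exports.
Local Open Scope classical_set_scope.
Local Open Scope ring_scope.

(* The coefficient map identifies the space B_K^p with l_p: well-definedness of
   the norm makes expansion in phi injective on l_p, and Hoelder makes the
   expansions converge.  The dual of l_p is l_q under the pairing
   <a, b> = sum a_n b_n, and l_q is in turn realized as a function space on
   Omega' by expansion in phi'.  Under these identifications K(x, .) is the
   element (phi_n(x))_n of l_q and K(., y) is the element (phi'_n(y))_n of l_p,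
   so that both reproducing properties say that evaluating an expansion is
   pairing its coefficients with these sequences. *)

(** * The p-norm of sequences, with the Minkowski and Hoelder inequalities *)

Section ell_theory.
Context {R : realType}.
Implicit Types (p q : R) (a b : R^nat).

Lemma ell_series_homo p a :
  {homo series (fun n => `|a n| `^ p) : m n / (m <= n)%N >-> m <= n}.
Proof. by apply: nondecreasing_series => n _ _; exact: powR_ge0. Qed.

Lemma series_le_ell_norm p a n : 0 < p -> ell p a ->
  series (fun k => `|a k| `^ p) n <= ell_norm p a `^ p.
Proof.
move=> p0 pa; rewrite /ell_norm -powRrM mulVf ?gt_eqF//.
have le_lim := nondecreasing_cvgn_le (ell_series_homo p a) pa.
(* Cancelling the exponents needs a nonnegative limit; the empty partial sum at index 0 bounds it
   below. *)
rewrite powRr1//; apply: le_trans (le_lim 0%N).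
by rewrite /series/= big_geq.
Qed.

Lemma ell_norm_ge0 p a : 0 <= ell_norm p a.
Proof. exact: powR_ge0. Qed.

Lemma ell_norm_le p a (C : R) : 0 < p -> 0 <= C ->
  (forall n, series (fun k => `|a k| `^ p) n <= C `^ p) ->
  ell p a /\ ell_norm p a <= C.
Proof.
move=> p0 C0 aC.
have pa : ell p a.
  apply: nondecreasing_is_cvgn; first exact: ell_series_homo.
  by exists (C `^ p) => _ [n _ <-].
have p_neq0 : p != 0 by rewrite gt_eqF.
split => //; rewrite /ell_norm -[leRHS]powRr1// -(mulfV p_neq0).
rewrite powRrM ge0_ler_powR ?nnegrE ?powR_ge0 ?invr_ge0 ?(ltW p0)//.
  apply: limr_ge => //; apply: nearW => n.
  by apply: sumr_ge0 => i _; exact: powR_ge0.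
by apply: limr_le => //; apply: nearW.
Qed.

(** The link to integration: the p-norm is the L^p norm for the counting measure, so the
    inequalities for integrals apply to sequences. *)
Lemma Lnorm_ell p a : 0 < p -> ell p a ->
  'N[counting]_p%:E[EFin \o a]%E = (ell_norm p a)%:E.
Proof.
move=> p0 pa; rewrite Lnorm_counting//.
under eq_eseriesr do rewrite /=.
rewrite (_ : limn _ = (limn (series (fun n => `|a n| `^ p)))%:E) ?poweR_EFin//.
rewrite -EFin_lim//; congr (limn _); apply/funext => n.
by rewrite /= /series/= sumEFin.
Qed.

(** The way back: a finite bound on the extended-real norm bounds every partial sum, which gives
    membership along with the estimate. *)
Lemma Lnorm_le_ell p a (C : R) : 0 < p -> 0 <= C ->
  ('N[counting]_p%:E[EFin \o a] <= C%:E)%E -> ell p a /\ ell_norm p a <= C.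
Proof.
move=> p0 C0; rewrite Lnorm_counting// => aC.
apply: ell_norm_le => // n; rewrite -lee_fin -poweR_EFin.
have p_neq0 : p != 0 by rewrite gt_eqF.
set S := limn _ in aC.
have S_ge0 : (0 <= S)%E by apply: nneseries_ge0 => k _ _; exact: poweR_ge0.
have : (S <= C%:E `^ p)%E.
  rewrite -[leLHS]poweRe1// -(mulVf p_neq0) poweRrM.
  by apply: gt0_ler_poweR => //;
    rewrite ?ltW// in_itv/= leey ?poweR_ge0//= lee_fin C0.
apply: le_trans; rewrite /series/= -sumEFin.
by apply: (@nneseries_lim_ge _ (fun k => (`|a k| `^ p)%:E) xpredT).
Qed.

Lemma ell_normD p a b : 1 <= p -> ell p a -> ell p b ->
  ell p (a + b) /\ ell_norm p (a + b) <= ell_norm p a + ell_norm p b.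
Proof.
move=> p1 pa pb; have p0 : 0 < p by exact: lt_le_trans p1.
apply: Lnorm_le_ell => //; first by rewrite addr_ge0// ell_norm_ge0.
have := @minkowski_EFin _ _ _ counting a b p (fun _ _ _ => I) (fun _ _ _ => I) p1.
by rewrite (Lnorm_ell p a p0 pa) (Lnorm_ell p b p0 pb) -EFinD.
Qed.

Lemma ell_normZ p (k : R) a : 0 < p -> ell p a ->
  ell p (fun n => k * a n) /\ ell_norm p (fun n => k * a n) = `|k| * ell_norm p a.
Proof.
move=> p0 pa.
have E : series (fun n => `|k * a n| `^ p) =
         `|k| `^ p *: series (fun n => `|a n| `^ p).
  apply/funext => n; rewrite /series/= fctE scaler_sumr.
  by apply: eq_bigr => i _; rewrite normrM powRM.
split; first by rewrite /ell/= E; exact: is_cvgZr.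
rewrite /ell_norm E limZr// powRM ?powR_ge0//.
  by rewrite -powRrM mulfV ?gt_eqF// powRr1.
apply: limr_ge => //; apply: nearW => n.
by apply: sumr_ge0 => i _; exact: powR_ge0.
Qed.

Lemma ell_norm0 p : 0 < p -> ell p (fun=> 0) /\ ell_norm p (fun=> 0) <= 0.
Proof.
move=> p0; apply: ell_norm_le => // n.
by rewrite /series/= big1// => i _; rewrite normr0 powR0// gt_eqF.
Qed.

Definition pairing a b : R := limn (series (fun n => a n * b n)).

Section hoelder.
Variables p q : R.
Hypotheses (p0 : 0 < p) (q0 : 0 < q) (pq : p^-1 + q^-1 = 1).

(** Hoelder for the counting measure. Having the product in l_1 means absolute convergence, whence
    both the convergence of the pairing and its bound. *)
Lemma pairing_norm_cvg a b : ell p a -> ell q b ->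
  ell 1 (a \* b) /\ ell_norm 1 (a \* b) <= ell_norm p a * ell_norm q b.
Proof.
move=> pa qb; apply: Lnorm_le_ell => //.
  by rewrite mulr_ge0// ell_norm_ge0.
have := @hoelder _ _ _ counting a b p q (fun _ _ _ => I) (fun _ _ _ => I) p0 q0 pq.
by rewrite (Lnorm_ell p a p0 pa) (Lnorm_ell q b q0 qb) -EFinM.
Qed.

Lemma normed_series_ell1 a b : [normed series (fun n => a n * b n)] =
  series (fun n => `|(a \* b) n| `^ 1).
Proof.
apply/funext => n; apply: eq_bigr => i _.
by rewrite powRr1.
Qed.

Lemma pairing_cvg a b : ell p a -> ell q b ->
  cvgn (series (fun n => a n * b n)).
Proof.
move=> pa qb; apply: normed_cvg; rewrite normed_series_ell1.
by have [] := pairing_norm_cvg _ _ pa qb.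
Qed.

Lemma pairing_le a b : ell p a -> ell q b ->
  `|pairing a b| <= ell_norm p a * ell_norm q b.
Proof.
move=> pa qb; have [h le1] := pairing_norm_cvg _ _ pa qb.
apply: le_trans le1; rewrite /ell_norm invr1 powRr1; last first.
  by apply: limr_ge => //; apply: nearW => n; apply: sumr_ge0 => *; exact: powR_ge0.
by rewrite -normed_series_ell1; apply: lim_series_norm; rewrite normed_series_ell1.
Qed.

Lemma pairing_linear (k : R) a a' b : ell p a -> ell p a' -> ell q b ->
  pairing (fun n => k * a n + a' n) b = k * pairing a b + pairing a' b.
Proof.
move=> pa pa' qb.
rewrite /pairing; have c := pairing_cvg _ _ pa qb; have c' := pairing_cvg _ _ pa' qb.
rewrite -[k * _]/(k *: _) -lim_seriesZ// -lim_seriesD//; last exact: is_cvg_seriesZ.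
by congr (limn (series _)); apply/funext => n; rewrite !fctE mulrDl -mulrA.
Qed.

End hoelder.
End ell_theory.

(* The exponent bound is a parameter of the type, so that canonical structures
   can retrieve it. *)
Definition ell_mem {R : realType} {p : R} (p1 : 1 <= p) : {pred nat -> R^o} :=
  fun a => `[< ell p a >].

Record lp {R : realType} {p : R} (p1 : 1 <= p) :=
  Lp { lp_val :> nat -> R^o ; lp_valP : lp_val \in ell_mem p1 }.
Arguments Lp {R p p1}.
Arguments lp_val {R p p1}.

(** * The normed space l_p *)

Section lp_normed.
Context {R : realType} {p : R} (p1 : 1 <= p).

Let p0 : 0 < p := lt_le_trans ltr01 p1.

HB.instance Definition _ := [isSub for @lp_val R p p1].
HB.instance Definition _ := [Choice of lp p1 by <:].

Lemma ell_submod_closed : GRing.subsemimod_closed (ell_mem p1).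
Proof.
split; first split.
- by apply/asboolP; have [] := ell_norm0 p p0.
- by move=> a b /asboolP pa /asboolP pb; apply/asboolP; have [] := ell_normD p a b p1 pa pb.
- by move=> k a /asboolP pa; apply/asboolP; have [] := ell_normZ p k a p0 pa.
Qed.

HB.instance Definition _ :=
  GRing.isSubmodClosed.Build R (nat -> R^o) (ell_mem p1) ell_submod_closed.
HB.instance Definition _ := [SubChoice_isSubLmodule of lp p1 by <:].

Lemma lpP (a : lp p1) : ell p a.
Proof. by case: a => a /= /asboolP. Qed.

Lemma lp_inj (a b : lp p1) : (forall n, a n = b n) -> a = b.
Proof. by move=> ab; apply: val_inj; apply/funext. Qed.

Let norm (a : lp p1) : R := ell_norm p a.

Let normD (a b : lp p1) : norm (a + b) <= norm a + norm b.
Proof. by have [] := ell_normD p a b p1 (lpP a) (lpP b). Qed.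

Let normZ (k : R) (a : lp p1) : norm (k *: a) = `|k| * norm a.
Proof. by have [] := ell_normZ p k a p0 (lpP a). Qed.

Let norm_eq0 (a : lp p1) : norm a = 0 -> a = 0.
Proof.
move=> a0; apply: lp_inj => n.
(* The partial sum of length [n.+1] is the first to contain the term of index [n]; it is at most 0^p
   = 0. *)
have := series_le_ell_norm p a n.+1 p0 (lpP a).
rewrite -/(norm a) a0 powR0 ?gt_eqF// /series/= big_nat_recr//= => h.
have /eqP : `|a n| `^ p = 0.
  apply/eqP; rewrite eq_le powR_ge0 andbT; apply: le_trans h.
  by rewrite lerDr; apply: sumr_ge0 => *; exact: powR_ge0.
by rewrite powR_eq0 normr_eq0 => /andP[/eqP].
Qed.

HB.instance Definition _ :=
  Lmodule_isNormed.Build R (lp p1) normD normZ norm_eq0.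

Lemma lp_normE (a : lp p1) : `|a| = ell_norm p a.
Proof. by []. Qed.

End lp_normed.
Arguments lpP {R p p1}.
Arguments lp_inj {R p p1}.
Arguments lp_normE {R p p1}.

(** * Truncations, their density, and completeness of l_p *)

Section lp_complete.
Context {R : realType} {p : R} {p1 : 1 <= p}.
Implicit Types (a : R^nat) (v : lp p1) (n : nat).

Let p0 : 0 < p := lt_le_trans ltr01 p1.

Lemma ell_unit n : ell p (fun k => (k == n)%:R : R) /\
  ell_norm p (fun k => (k == n)%:R : R) <= 1.
Proof.
apply: ell_norm_le => // m; rewrite powR1 /series/=.
apply: le_trans (_ : \sum_(0 <= k < m) ((k == n)%:R : R) <= 1).
  by apply: ler_sum => k _; case: eqP => _; rewrite ?normr1 ?powR1// normr0 powR0 ?gt_eqF.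
rewrite -natr_sum lern1 big_mkord.
have [nm|mn] := ltnP n m.
  by rewrite (bigD1 (Ordinal nm))//= eqxx big1// => i; rewrite -val_eqE/= => /negbTE ->.
by rewrite big1// => i _; rewrite ltn_eqF// (leq_trans (ltn_ord i)).
Qed.

Definition lp_unit n : lp p1 :=
  Lp (fun k => (k == n)%:R) (asboolT (ell_unit n).1).

Lemma lp_unit_norm n : `|lp_unit n| <= 1.
Proof. exact: (ell_unit n).2. Qed.

(** Defined for any sequence, so that truncations can test membership in l_p; written through unit
    vectors, so that linear functionals can be evaluated on it. *)
Definition trunc n a : lp p1 := \sum_(i < n) a i *: lp_unit i.

Lemma truncS n a : trunc n.+1 a = trunc n a + a n *: lp_unit n.
Proof. exact: big_ord_recr. Qed.

Lemma truncD n a b : trunc n (a + b) = trunc n a + trunc n b.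
Proof. by rewrite /trunc -big_split; apply: eq_bigr => i _; rewrite /= -scalerDl. Qed.

Lemma trunc_coef n a k : trunc n a k = if (k < n)%N then a k else 0.
Proof.
elim: n => [|n IH]; first by rewrite /trunc big_ord0.
rewrite truncS -[LHS]/(trunc n a k + a n * (k == n)%:R) IH ltnS.
case: ltngtP => [kn|kn|->]; rewrite ?mulr0 ?addr0 ?mulr1 ?add0r//.
Qed.

Lemma trunc_norm_ge n a : series (fun k => `|a k| `^ p) n <= `|trunc n a| `^ p.
Proof.
rewrite lp_normE; apply: le_trans (series_le_ell_norm p (trunc n a) n p0 (lpP _)).
rewrite /series/= !big_mkord; apply: ler_sum => i _.
by rewrite trunc_coef ltn_ord.
Qed.

Lemma trunc_norm_le n a (C : R) : 0 <= C ->
  series (fun k => `|a k| `^ p) n <= C `^ p -> `|trunc n a| <= C.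
Proof.
move=> C0 aC; apply: (ell_norm_le p (trunc n a) C p0 C0 _).2 => m.
(* Passing to length max(m, n) brings in all indices below n; the remaining terms of the truncation
   vanish. *)
apply: le_trans aC; apply: le_trans (ell_series_homo _ _ _ _ (leq_maxl m n)) _.
rewrite [leRHS]/series/= (big_nat_widen 0 n (maxn m n)) ?leq_maxr//.
rewrite [leRHS]big_mkcond/=; apply: ler_sum => i _; rewrite trunc_coef.
by case: ifP => // _; rewrite normr0 powR0// gt_eqF.
Qed.

Lemma trunc_le n v : `|trunc n v| <= `|v|.
Proof. by apply: trunc_norm_le => //; apply: series_le_ell_norm => //; exact: lpP. Qed.

Lemma ell_of_trunc a (C : R) : 0 <= C -> (forall n, `|trunc n a| <= C) ->
  ell p a /\ ell_norm p a <= C.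
Proof.
move=> C0 aC; apply: ell_norm_le => // n.
apply: le_trans (trunc_norm_ge n a) _.
by apply: ge0_ler_powR; rewrite ?nnegrE ?(ltW p0).
Qed.

Lemma trunc_dense v (e : R) : 0 < e -> exists n, `|v - trunc n v| <= e.
Proof.
move=> e0; have ep : 0 < e `^ p by exact: powR_gt0.
(* The p-th power of the error is a tail of the series of v, so n is chosen to make that tail at
   most e^p. *)
have /cvgrPdist_le/(_ _ ep) [n _ vn] := lpP v.
exists n; apply: (ell_norm_le p (v - trunc n v) e p0 (ltW e0) _).2 => m.
apply: le_trans (ell_series_homo _ _ _ _ (leq_maxl m n)) _.
apply: le_trans (vn n (leqnn n)).
rewrite ger0_norm ?subr_ge0; last first.
  exact: nondecreasing_cvgn_le (ell_series_homo p v) (lpP v) n.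
apply: (@le_trans _ _ (series (fun k => `|v k| `^ p) (maxn m n) -
                       series (fun k => `|v k| `^ p) n)); last first.
  by rewrite lerB//; exact: nondecreasing_cvgn_le (ell_series_homo p v) (lpP v) _.
rewrite lerBrDr /series/= [X in _ + X](big_nat_widen 0 n (maxn m n)) ?leq_maxr//.
rewrite [X in _ + X]big_mkcond/= -big_split/=; apply: ler_sum => i _.
rewrite -[X in `|X|]/(v i - trunc n v i) trunc_coef; case: ifP => _.
  by rewrite subrr normr0 powR0 ?add0r// gt_eqF.
by rewrite subr0 addr0.
Qed.

(** Coefficients are thus 1-Lipschitz in the sequence, so a Cauchy filter on l_p induces Cauchy
    filters of coefficients. *)
Lemma coef_le v n : `|v n| <= `|v|.
Proof.
have := series_le_ell_norm p v n.+1 p0 (lpP v).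
rewrite /series/= big_nat_recr//= => h.
rewrite leNgt; apply/negP => vn.
have : `|v n| `^ p <= `|v| `^ p.
  by apply: le_trans h; rewrite lerDr; apply: sumr_ge0 => *; exact: powR_ge0.
by rewrite leNgt gt0_ltr_powR// ?nnegrE.
Qed.

(* The limit is taken coefficientwise; the norm bounds pass to it through the
   truncations, on which the norm is controlled by finitely many coefficients. *)
Lemma lp_cauchy_cvg (F : set_system (lp p1)) :
  ProperFilter F -> cauchy F -> cvg F.
Proof.
move=> FF /cauchyP Fc.
have Fcoef n : cvg ((fun v : lp p1 => v n) @ F).
  apply: cauchy_cvg; apply/cauchyP => e e0; have [x Fx] := Fc e e0.
  exists (x n); apply: (@filterS _ F _ (ball x e)) Fx => v.
  rewrite -!ball_normE /ball_/= => xv.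
  by apply: le_lt_trans xv; exact: (coef_le (x - v) n).
pose a n := lim ((fun v : lp p1 => v n) @ F).
(* Only finitely many coefficients are involved for fixed n; each induction step spends half of the
   tolerance on the new one. *)
have small n (d : R) : 0 < d -> \forall v \near F, `|trunc n (a - lp_val v)| <= d.
  elim: n d => [d d0|n IH d d0].
    by apply: nearW => v; rewrite /trunc big_ord0 normr0 ltW.
  have d2 : 0 < d / 2 by rewrite divr_gt0.
  have h : \forall v \near F, `|a n - lp_val v n| <= d / 2.
    by move/cvgrPdist_le: (Fcoef n) => /(_ _ d2).
  apply: filterS2 (IH _ d2) h => v h1 h2.
  rewrite truncS [leRHS]splitr; apply: le_trans (ler_normD _ _) _.
  apply: lerD h1 _; rewrite normrZ -[leRHS]mulr1.
  by apply: ler_pM h2 _ => //; exact: lp_unit_norm.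
(* For each n, compare a with x through some v in the ball whose n-th truncation is d-close to that
   of a. This v depends on n and d, but the resulting bound e + d does not depend on n, and d is
   arbitrary. *)
have key x (e : R) : 0 < e -> F (ball x e) ->
    ell p (a - lp_val x) /\ ell_norm p (a - lp_val x) <= e.
  move=> e0 Fx; apply: ell_of_trunc => [|n]; first exact: ltW.
  apply/ler_addgt0Pr => d d0.
  have [v [+ av]] := filter_ex (filterI Fx (small n d d0)).
  rewrite -ball_normE /ball_/= distrC => xv.
  have -> : a - lp_val x = (a - lp_val v) + lp_val (v - x).
    by apply/funext => k; rewrite !fctE -[(v - x) k]/(v k - x k) addrA subrK.
  rewrite truncD addrC; apply: le_trans (ler_normD _ _) _; apply: lerD av.
  by apply: le_trans (ltW xv); exact: trunc_le.
have [x Fx] := Fc 1 ltr01.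
have pa : ell p a.
  have [h _] := key _ _ ltr01 Fx.
  have -> : a = (a - lp_val x) + lp_val x by rewrite subrK.
  by have [] := ell_normD p _ _ p1 h (lpP x).
apply/cvg_ex; exists (Lp a (asboolT pa)).
apply/cvgrPdist_le => e e0.
have e2 : 0 < e / 2 by rewrite divr_gt0.
have [y Fy] := Fc _ e2; have [_ ay] := key _ _ e2 Fy.
apply: filterS Fy => v; rewrite -ball_normE /ball_/= => yv.
rewrite -(subrK y (Lp _ _)) -addrA [leRHS]splitr.
apply: le_trans (ler_normD _ _) _; exact: lerD ay (ltW yv).
Qed.

End lp_complete.

HB.instance Definition _ {R : realType} {p : R} (p1 : 1 <= p) :=
  Uniform_isComplete.Build (lp p1) (@lp_cauchy_cvg R p p1).

Lemma pairingC {R : realType} (a b : R^nat) : pairing a b = pairing b a.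
Proof. by rewrite /pairing; under eq_fun do rewrite mulrC. Qed.

Lemma pairing_unit {R : realType} (a : R^nat) n :
  pairing a (fun k => (k == n)%:R) = a n.
Proof.
apply: cvg_lim => //; apply: cvg_near_cst; exists n.+1 => // m /= nm.
rewrite /series/= big_mkord (bigD1 (Ordinal nm))//= eqxx mulr1 big1 ?addr0//.
by move=> i; rewrite -val_eqE/= => /negbTE ->; rewrite mulr0.
Qed.

(** * Bounded functionals and the dual norm *)

Section dual_norm.
Context {R : realType} {V : normedModType R}.
Variables (G : V -> R^o) (C : R).
Hypotheses (Glin : linear G) (C0 : 0 <= C) (GC : forall v, `|G v| <= C * `|v|).

HB.instance Definition _ := GRing.isLinear.Build R V R^o _ G Glin.

Let ball_image := [set `|G v| | v in [set v : V | `|v| <= 1]].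

(** With the nonemptiness proved next, this makes the [sup] in [dual_norm] a genuine supremum. *)
Let ball_image_ub : ubound ball_image C.
Proof.
move=> _ [v /= v1 <-]; apply: le_trans (GC v) _.
by rewrite -[leRHS]mulr1; exact: ler_wpM2l.
Qed.

Let ball_image0 : ball_image 0.
Proof. by exists 0 => /=; rewrite ?normr0 ?ler01// linear0 normr0. Qed.

Lemma dual_norm_le : dual_norm G <= C.
Proof. by apply: ge_sup => //; exists 0. Qed.

Let ub_dual_norm v : `|v| <= 1 -> `|G v| <= dual_norm G.
Proof.
move=> v1; apply: ub_le_sup; last by exists v.
by exists C.
Qed.

Lemma dual_norm_ge0 : 0 <= dual_norm G.
Proof. by have := ub_dual_norm 0; rewrite linear0 !normr0 ler01; exact. Qed.

Lemma le_dual_norm v : `|G v| <= dual_norm G * `|v|.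
Proof.
have [->|v0] := eqVneq v 0; first by rewrite linear0 !normr0 mulr0.
have nv : 0 < `|v| by rewrite normr_gt0.
rewrite -ler_pdivrMr// mulrC -[X in X * _](@ger0_norm R); last first.
  by rewrite invr_ge0 normr_ge0.
rewrite -normrM -[_ * G v]/(_ *: G v) -linearZ; apply: ub_dual_norm.
by rewrite normrZ ger0_norm ?invr_ge0// mulVf// gt_eqF.
Qed.

Lemma bounded_functional_continuous : continuous G.
Proof.
apply/bounded_linear_continuous/linear_boundedP.
by near=> r => x; apply: le_trans (GC x) _; exact: ler_wpM2r.
Unshelve. all: by end_near. Qed.

End dual_norm.

Lemma continuous_functional_bounded {R : realType} {V : normedModType R}
    (G : V -> R^o) : linear G -> continuous G ->
  exists2 C, 0 <= C & forall v, `|G v| <= C * `|v|.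
Proof.
move=> Glin Gc.
pose GL := GRing.isLinear.Build R V R^o _ G Glin.
pose G' : {linear V -> R^o} := HB.pack G GL.
have /linear_bounded_continuous/linear_boundedP/pinfty_ex_gt0 [C C0 GC] :
  continuous G' by [].
by exists C => //; exact: ltW.
Qed.

(** * The duality between l_p and l_q *)

Section lp_dual.
Context {R : realType} {p q : R} {p1 : 1 <= p} {q1 : 1 <= q}.
Hypothesis pq : p^-1 + q^-1 = 1.

Let p0 : 0 < p := lt_le_trans ltr01 p1.
Let q0 : 0 < q := lt_le_trans ltr01 q1.
Let qp : q^-1 + p^-1 = 1.
Proof. by rewrite addrC. Qed.

Section functional.
Variables (G : lp p1 -> R^o) (C : R).
Hypotheses (Glin : linear G) (C0 : 0 <= C) (GC : forall v, `|G v| <= C * `|v|).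

HB.instance Definition _ := GRing.isLinear.Build R (lp p1) R^o _ G Glin.

Lemma functional_trunc n a : G (trunc n a) = \sum_(i < n) a i * G (lp_unit i).
Proof. by rewrite /trunc linear_sum; apply: eq_bigr => i _; rewrite linearZ. Qed.

(* Testing [G] on truncations of c_k = sgn(b_k) |b_k|^(q-1), where
   b_k = G(e_k), gives S <= C S^(1/p) for each partial sum S of |b_k|^q. *)
Lemma functional_coef_ell :
  ell q (fun n => G (lp_unit n)) /\ ell_norm q (fun n => G (lp_unit n)) <= C.
Proof.
apply: ell_norm_le => // n; set b := fun n => G (lp_unit n).
pose c k := Num.sg (b k) * `|b k| `^ (q - 1).
set S := series _ n.
have S0 : 0 <= S by apply: sumr_ge0 => *; exact: powR_ge0.
(* Conjugacy of the exponents, which turns |c_k|^p into |b_k|^q. *)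
have q1p : (q - 1) * p = q.
  apply: (mulIf (x := p^-1)); first by rewrite invr_eq0 gt_eqF.
  rewrite mulfK ?gt_eqF// -[p^-1](addrK q^-1) pq mulrBr mulr1 mulfV//.
  by rewrite gt_eqF.
have GS : G (trunc n c) = S.
  rewrite functional_trunc /S /series/= big_mkord; apply: eq_bigr => i _.
  rewrite -/(b i) /c mulrAC -normrEsg.
  by rewrite -{1}[`|b i|]powRr1// -powRD ?subrKC// (gt_eqF q0).
have cS : `|trunc n c : lp p1| <= S `^ p^-1.
  apply: trunc_norm_le; first exact: powR_ge0.
  rewrite -powRrM mulVf ?gt_eqF// powRr1//; apply: ler_sum => i _.
  rewrite normrM normr_sg; have [->|bi] := eqVneq (b i) 0.
    by rewrite mul0r powR0 ?gt_eqF// powR_ge0.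
  by rewrite mul1r ger0_norm ?powR_ge0// -powRrM q1p.
have SC : S <= C * S `^ p^-1.
  apply: le_trans (ler_wpM2l C0 cS); apply: le_trans (GC _).
  by rewrite GS ler_norm.
(* S = 0 is set apart, since S^(1/p) is about to be divided out. *)
move: S0; rewrite le_eqVlt => /predU1P[<-|S0]; first exact: powR_ge0.
have : S `^ q^-1 <= C.
  rewrite -(ler_pM2r (powR_gt0 p^-1 S0)) -powRD ?qp ?powRr1 ?(ltW S0)//.
  by rewrite oner_eq0.
move=> /(ge0_ler_powR (ltW q0)); rewrite !nnegrE powR_ge0 C0 => /(_ isT isT).
by rewrite -powRrM mulVf ?gt_eqF// powRr1// ltW.
Qed.

(** G vanishes on truncations, which are dense, and G is bounded. *)
Lemma functional_eq0 : (forall n, G (lp_unit n) = 0) -> forall v, G v = 0.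
Proof.
move=> G0 v; apply/eqP; rewrite -normr_eq0 eq_le normr_ge0 andbT.
apply/ler_addgt0Pr => e e0; rewrite add0r.
(* C may be 0, so the tolerance is divided by C + 1. *)
have C1 : 0 < C + 1 by rewrite ltr_pwDr.
have [n vn] := trunc_dense v (e / (C + 1)) (divr_gt0 e0 C1).
have -> : G v = G (v - trunc n v).
  have -> : G (v - trunc n v) = G v - G (trunc n v) by exact: linearB.
  by rewrite functional_trunc big1 ?subr0// => i _; rewrite G0 mulr0.
apply: le_trans (GC _) _.
rewrite -[leRHS](divfK (lt0r_neq0 C1)) mulrC.
by apply: ler_pM => //; rewrite lerDl.
Qed.

End functional.

Definition lp_pair (g : lp q1) (f : lp p1) : R^o := pairing g f.

Lemma lp_pair_le g f : `|lp_pair g f| <= `|g| * `|f|.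
Proof. by apply: pairing_le => //; exact: lpP. Qed.

Lemma lp_pair_linear : linear lp_pair.
Proof.
move=> k g g'; apply/funext => f.
exact: (pairing_linear _ _ q0 p0 qp k _ _ _ (lpP g) (lpP g') (lpP f)).
Qed.

Lemma lp_pair_linearr g : linear (lp_pair g).
Proof.
move=> k f f'; rewrite /lp_pair ![pairing g _]pairingC.
exact: (pairing_linear _ _ p0 q0 pq k _ _ _ (lpP f) (lpP f') (lpP g)).
Qed.

Lemma lp_pair_unit g n : lp_pair g (lp_unit n) = g n.
Proof. exact: pairing_unit. Qed.

(** Unit vectors recover the coefficients of g, hence injectivity; the values of a functional on
    them form its preimage in l_q. *)
Lemma lp_pair_isometry : dual_isometry lp_pair.
Proof.
split; first exact: lp_pair_linear.
  split.
  - move=> g _; split; first exact: lp_pair_linearr.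
    exact: bounded_functional_continuous (lp_pair_linearr g) (lp_pair_le g).
  - move=> g g' _ _ gg'; apply: lp_inj => n.
    by rewrite -!lp_pair_unit gg'.
  move=> G [Glin /(continuous_functional_bounded _ Glin) [C C0 GC]].
  have [qb _] := functional_coef_ell G C Glin C0 GC.
  pose g : lp q1 := Lp (fun n => G (lp_unit n)) (asboolT qb).
  exists g => //; apply/funext => v; apply/eqP; rewrite -subr_eq0; apply/eqP.
  (* The difference of the two functionals vanishes on unit vectors and is bounded by the sum of
     their bounds. *)
  apply: (functional_eq0 (fun v => lp_pair g v - G v) (`|g| + C)).
  - move=> k u w; rewrite lp_pair_linearr Glin /= scalerBr.
    by rewrite opprD addrACA.
  - by rewrite addr_ge0.
  - move=> w; rewrite mulrDl; apply: le_trans (ler_normB _ _) _.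
    by apply: lerD => //; exact: lp_pair_le.
  - by move=> n; rewrite lp_pair_unit subrr.
move=> g; have glin := lp_pair_linearr g; have gle := lp_pair_le g.
apply/eqP; rewrite eq_le (dual_norm_le _ _ glin)//=.
(* Hoelder gave one inequality; the other is the coefficient estimate with the dual norm itself as
   constant. *)
have [_] := functional_coef_ell _ _ glin
  (dual_norm_ge0 _ _ glin (normr_ge0 g) gle) (le_dual_norm _ _ glin (normr_ge0 g) gle).
by under eq_fun do rewrite lp_pair_unit.
Qed.

End lp_dual.

(** * Spaces of expansions as function spaces *)

Section expansion.
Context {R : realType} {p q : R} (p1 : 1 <= p).
Hypotheses (q0 : 0 < q) (pq : p^-1 + q^-1 = 1).
Context {d : measure_display} {T : measurableType d} (phi : nat -> T -> R).
Hypothesis phi_ell : forall x, ell q (phi ^~ x).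

Let p0 : 0 < p := lt_le_trans ltr01 p1.

Definition expansion (a : lp p1) (x : T) : R^o := pairing a (phi ^~ x).

Lemma expansionP (a : lp p1) : is_expansion phi a (expansion a).
Proof. by move=> x; exact: pairing_cvg p0 q0 pq _ _ (lpP a) (phi_ell x). Qed.

Lemma is_expansion_unique (a : lp p1) f : is_expansion phi a f -> f = expansion a.
Proof. by move=> af; apply/funext => x; apply/esym/cvg_lim. Qed.

Lemma range_expansion : range expansion = expansion_space p phi.
Proof.
apply/seteqP; split => [_ [a _ <-]|f [a pa af]].
  by exists (lp_val a); [exact: lpP|exact: expansionP].
exists (Lp a (asboolT pa)) => //; apply/esym.
exact: (is_expansion_unique (Lp a (asboolT pa))).
Qed.

Hypothesis norm_wd : expansion_norm_well_defined p phi.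

(** The coefficients selected by [get] may differ from those of [a]; well-definedness equates their
    norms. *)
Lemma expansion_normE (a : lp p1) : expansion_norm p phi (expansion a) = `|a|.
Proof.
rewrite /expansion_norm; set P := [set b | _].
have [pb bP] : P (get P).
  by apply: getPex; exists (lp_val a); split; [exact: lpP|exact: expansionP].
exact: norm_wd pb (lpP a) bP (expansionP a).
Qed.

Lemma expansion_function_space : (forall n, L0 (phi n)) -> function_space expansion.
Proof.
move=> phi_meas; have lin : linear expansion.
  move=> k a b; apply/funext => x.
  exact: (pairing_linear _ _ p0 q0 pq k _ _ _ (lpP a) (lpP b) (phi_ell x)).
split => //.
  (* Injectivity: a - b and 0 have the same expansion, and the norm depends on the expansion
     alone. *)
  move=> a b ab; apply/eqP; rewrite -subr_eq0 -normr_eq0 -expansion_normE.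
  have -> : expansion (a - b) = expansion 0.
    rewrite addrC -scaleN1r lin ab scaleN1r addNr.
    by rewrite -[0 in RHS](addNr (0 : lp p1)) -scaleN1r lin scaleN1r addNr.
  by rewrite expansion_normE normr0.
move=> a; apply: measurable_fun_cvg => [n|x _]; last exact: expansionP.
apply: measurable_sum => i.
exact: measurable_funM (measurable_cst _) (phi_meas i).
Qed.

End expansion.

Theorem theorem3p8 (R : realType) (Omega Omega' : ptopologicalType)
  (mu : {measure set (borel Omega) -> \bar R})
  (mu' : {measure set (borel Omega') -> \bar R})
  (p q : R) (K : borel Omega * borel Omega' -> R)
  (phi : nat -> borel Omega -> R) (phi' : nat -> borel Omega' -> R)
  (lcOmega : locally_compact [set: Omega]) (hOmega : hausdorff_space Omega)
  (lcOmega' : locally_compact [set: Omega']) (hOmega' : hausdorff_space Omega')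
  (mu_regular : regular_borel_measure mu)
  (mu'_regular : regular_borel_measure mu')
  (p_gt1 : 1 < p) (q_gt1 : 1 < q) (pq : p^-1 + q^-1 = 1)
  (K_mercer : generalized_mercer_kernel K phi phi')
  (phi_free : linearly_independent phi)
  (phi'_free : linearly_independent phi')
  (phi_summable : forall x, cvgn (series (fun n => `|phi n x| `^ q)))
  (phi'_summable : forall y, cvgn (series (fun n => `|phi' n y| `^ p)))
  (norm_wd : expansion_norm_well_defined p phi)
  (norm_wd' : expansion_norm_well_defined q phi') :
  is_two_sided_rkbs K (expansion_space p phi) (expansion_norm p phi).
Proof.
have [p1 q1] := (ltW p_gt1, ltW q_gt1).
have [p0 q0] := (lt_trans ltr01 p_gt1, lt_trans ltr01 q_gt1).
have qp : q^-1 + p^-1 = 1 by rewrite addrC.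
have [K_meas phi_meas phi'_meas KE] := K_mercer.
exists (lp p1), (expansion p1 phi); split.
- exact: (range_expansion p1 q0 pq phi phi_summable).
- exact: (expansion_normE p1 q0 pq phi phi_summable norm_wd).
split => //.
  exact: (expansion_function_space p1 q0 pq phi phi_summable norm_wd phi_meas).
exists (lp q1), (expansion q1 phi'), lp_pair; split.
- exact: (expansion_function_space q1 p0 qp phi' phi'_summable norm_wd' phi'_meas).
- exact: lp_pair_isometry.
split => [x|y].
  exists (Lp (phi ^~ x) (asboolT (phi_summable x))) => [|f].
    by apply/funext => y; exact: cvg_lim (KE x y).
  exact: pairingC.
(* On this side the pairing is evaluation by definition; the other side needed its symmetry. *)
exists (Lp (phi' ^~ y) (asboolT (phi'_summable y))) => //.
by apply/funext => x; rewrite /expansion pairingC; exact: cvg_lim (KE x y).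
Qed.
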